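(* Let $m\ge 0$ be an integer. Let $P$ be an $m$-L-bounded poset, and let $e=e(P)$. Then for all $n$, $$\mathrm{La}(n,P)\le \Sigma(n,e)+2\sum_{i=0}^{m-1}\binom{n}{i}.$$ Hence, the limit $\pi(P)=\lim_{n\to\infty}\mathrm{La}(n,P)/\binom{n}{\lfloor n/2\rfloor}$ exists and $\pi(P)=e$.
   Context: All posets are finite and nonempty. Let $[n]=\{1,\dots,n\}$; families of subsets of $[n]$ are ordered by inclusion. A poset $(P,\le)$ contains a poset $(P',\le')$ as a (weak) subposet if there is an injection $f:P'\to P$ such that $u\le' v$ implies $f(u)\le f(v)$. A family $\mathcal F\subseteq 2^{[n]}$ is $P$-free if it does not contain $P$ in this sense. $\mathrm{La}(n,P)$ is the largest size of a $P$-free family $\mathcal F\subseteq 2^{[n]}$. $e(P)$ is the maximum integer $k\ge 0$ such that for all integers $n$ and $s$ the family $\binom{[n]}{s}\cup\binom{[n]}{s+1}\cup\cdots\cup\binom{[n]}{s+k-1}$ is $P$-free, where $\binom{[n]}{j}$ is the collection of $j$-element subsets of $[n]$ (empty if $j<0$ or $j>n$). $\Sigma(n,k)=\sum_{i=\lfloor (n-k+1)/2\rfloor}^{\lfloor (n+k-1)/2\rfloor}\binom{n}{i}$ is the number of subsets of $[n]$ in the $k$ middle levels (with $\binom{n}{i}=0$ for $i<0$ or $i>n$). The Lubell function of $\mathcal F\subseteq 2^{[n]}$ is the average over all $n!$ full (maximal) chains $\mathcal C$ of $2^{[n]}$ of $|\mathcal F\cap\mathcal C|$; equivalently $\bar h_n(\mathcal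 F)=\sum_{F\in\mathcal F}1/\binom{n}{|F|}$. For an integer $m\ge0$, $P$ is $m$-L-bounded if for all $n$, $\bar h_n(\mathcal F)\le e(P)$ for every $P$-free family $\mathcal F$ of subsets of $[n]$ all of whose members have sizes in $[m,n-m]$. *)

(* Defs.v *)
From HB Require Import structures.
From mathcomp Require Import all_boot all_order all_algebra.
From mathcomp Require Import all_classical all_reals all_analysis.

Set Implicit Arguments.
Unset Strict Implicit.
Unset Printing Implicit Defensive.

Import Order.TTheory GRing.Theory Num.Theory.
Import numFieldNormedType.Exports.

(* The ground set [n] = {1, ..., n} is represented by 'I_n. *)

Definition contains (n : nat) (F : {set {set 'I_n}})
    (d : Order.disp_t) (P : finPOrderType d) : bool :=
  [exists f : {ffun P -> {set 'I_n}},
    [&& injectiveb f,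
        [forall u, f u \in F] &
        [forall u, forall v, (u <= v)%O ==> (f u \subset f v)]]].

Definition is_free (d : Order.disp_t) (P : finPOrderType d) (n : nat)
    (F : {set {set 'I_n}}) : bool := ~~ contains F P.

Definition La (n : nat) (d : Order.disp_t) (P : finPOrderType d) : nat :=
  \max_(F : {set {set 'I_n}} | is_free P F) #|F|.

(* The k consecutive levels s, ..., s + k - 1 of 2^[n]; s may be negative. *)
Definition levels (n : nat) (s : int) (k : nat) : {set {set 'I_n}} :=
  [set A : {set 'I_n} | (s <= #|A|%:Z < s + k%:Z)%R].

Definition levels_free (d : Order.disp_t) (P : finPOrderType d) (k : nat) :
    Prop :=
  forall (n : nat) (s : int), is_free P (levels n s k).

(* e(P): the largest k satisfying levels_free P k, selected by classical
   choice; for nonempty P it exists, see e_ofP below. The value on the empty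
   poset is irrelevant. *)
Definition e_of (d : Order.disp_t) (P : finPOrderType d) : nat :=
  xget 0 [set k | levels_free P k /\
                  forall j, levels_free P j -> j <= k]%classic.

(* The sum from floor((n-k+1)/2) to floor((n+k-1)/2), the latter included:
   the exclusive upper bound is floor((n+k+1)/2), and truncating n-k+1 at 0
   only discards indices i < 0. *)
Definition Sigma (n k : nat) : nat :=
  \sum_((n.+1 - k)./2 <= i < (n + k).+1./2) 'C(n, i).

Definition is_chain (n : nat) (C : {set {set 'I_n}}) : bool :=
  [forall A in C, forall B in C, (A \subset B) || (B \subset A)].

Definition full_chains (n : nat) : {set {set {set 'I_n}}} :=
  [set C : {set {set 'I_n}} | maxset (@is_chain n) C].

Definition lubell (n : nat) (F : {set {set 'I_n}}) : rat :=
  ((\sum_(C in full_chains n) #|F :&: C|)%:R / #|full_chains n|%:R)%R.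

(* When n < m the truncated bound n - m = 0 is harmless: then m > 0 and the
   range of sizes is empty, as it should be. *)
Definition L_bounded (m : nat) (d : Order.disp_t) (P : finPOrderType d) :
    Prop :=
  forall (n : nat) (F : {set {set 'I_n}}),
    is_free P F ->
    (forall A, A \in F -> m <= #|A| <= n - m) ->
    (lubell F <= (e_of P)%:R)%R.

Definition La_ratio (R : realType) (d : Order.disp_t) (P : finPOrderType d) :
    R^nat :=
  fun n => ((La n P)%:R / 'C(n, n./2)%:R)%R.

Definition pi_limit (R : realType) (d : Order.disp_t) (P : finPOrderType d) :
    R :=
  limn (La_ratio R P).

Lemma levels_free0 (d : Order.disp_t) (P : finPOrderType d) :
  0 < #|P| -> levels_free P 0.
Proof.
move=> /card_gt0P[x _] n s; apply/existsPn => f; apply/negP => /and3P[_ h _].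
move/forallP: h => /(_ x); rewrite inE addr0 => /andP[h1 h2].
by move: (le_lt_trans h1 h2); rewrite ltxx.
Qed.

Lemma levels_free_le (d : Order.disp_t) (P : finPOrderType d) (k : nat) :
  levels_free P k -> k <= #|P|.
Proof.
move=> h; rewrite leqNgt; apply/negP => ltPk; move: (h #|P| 0%R).
apply/negP; rewrite negbK; apply/existsP.
pose f (u : P) := [set enum_rank v | v in [pred v : P | (v <= u)%O]].
have fE u v : (enum_rank v \in f u) = (v <= u)%O.
  by rewrite mem_imset ?inE //; apply: enum_rank_inj.
exists [ffun u => f u]; apply/and3P; split.
- apply/injectiveP => u v; rewrite !ffunE => fuv; apply: le_anti.
  by rewrite -fE -fuv fE lexx -fE fuv fE lexx.
- apply/forallP => u; rewrite ffunE inE add0r /= ltz_nat.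
  by apply: leq_ltn_trans ltPk; rewrite -[leqRHS]card_ord max_card.
- apply/forallP => u; apply/forallP => v; apply/implyP => uv; rewrite !ffunE.
  apply/fintype.subsetP => i; rewrite -[i]enum_valK !fE => iu; exact: le_trans iu uv.
Qed.

Lemma e_ofP (d : Order.disp_t) (P : finPOrderType d) :
  0 < #|P| ->
  levels_free P (e_of P) /\ forall j, levels_free P j -> j <= e_of P.
Proof.
move=> P0; rewrite /e_of; case: xgetP => [k _ //|no].
have ex0 : exists k, `[< levels_free P k >].
  by exists 0; apply/asboolP; apply: levels_free0.
have le_P k : `[< levels_free P k >] -> k <= #|P|.
  by move/asboolP; apply: levels_free_le.
case: (ex_maxnP ex0 le_P) => k /asboolP hk kmax.
by case: (no k); split=> // j hj; apply: kmax; apply/asboolP.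
Qed.

(* Main.v *)
(* A maximal chain meets each of the levels 0, ..., n exactly once and the
   symmetric group permutes each level transitively, so the Lubell function is
   the sum of 1 / 'C(n, |A|). Hence a family with Lubell function at most e is
   largest when it fills the e levels of smallest weight, the middle ones.
   Discarding the sets of size < m or > n - m from a P-free family costs at most
   2 \sum_(i < m) 'C(n, i) and makes L-boundedness applicable.
   For the limit, the levels n/2 - e, ..., n/2 - 1 form a P-free family; binomial
   coefficients at bounded distance from the centre differ from the central one
   by a relative O(1/n), while 'C(n, i) with i bounded is itself O(1/n) times the
   central one, so the ratio is e + O(1/n). *)

Require Import Defs.
From HB Require Import structures.
From mathcomp Require Import all_boot all_order all_algebra.
From mathcomp Require Import all_classical all_reals all_analysis.
From mathcomp Require Import perm zify ring lra.
Import numFieldNormedType.Exports.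
Import Order.TTheory GRing.Theory Num.Theory.

Set Implicit Arguments.
Unset Strict Implicit.
Unset Printing Implicit Defensive.

(** * Binomial coefficients near the centre and far from it *)

Lemma bin_le_succ n i : i.*2 < n -> 'C(n, i) <= 'C(n, i.+1).
Proof.
move=> lt_in; rewrite -(leq_pmul2l (ltn0Sn i)) mul_bin_left leq_mul2r.
by apply/orP; right; lia.
Qed.

Lemma bin_le_lower_half n i j : i <= j -> j.*2 <= n -> 'C(n, i) <= 'C(n, j).
Proof.
elim: j => [|j IH]; first by rewrite leqn0 => /eqP->.
rewrite leq_eqVlt => /predU1P[->//|le_ij] le_jn.
by apply: leq_trans (IH _ _) (bin_le_succ _); lia.
Qed.

Lemma bin_minn n i : i <= n -> 'C(n, i) = 'C(n, minn i (n - i)).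
Proof. by move=> le_in; case: leqP => // _; rewrite bin_sub. Qed.

(** The reflection [i -> n - i] moves both indices into the lower half, where the coefficients
    increase. *)
Lemma bin_le_minn n i j :
  j <= n -> minn i (n - i) <= minn j (n - j) -> 'C(n, i) <= 'C(n, j).
Proof.
move=> le_jn le_ij; case: (leqP i n) => [le_in|lt_ni]; last by rewrite bin_small.
by rewrite bin_minn // [leqRHS]bin_minn // bin_le_lower_half //; lia.
Qed.

Lemma bin_le_central n i : 'C(n, i) <= 'C(n, n./2).
Proof.
case: (leqP i n) => [le_in|lt_ni]; last by rewrite bin_small.
by apply: bin_le_minn; lia.
Qed.

Lemma bin_near_central n k : k <= n./2 ->
  n * 'C(n, n./2) <= n * 'C(n, n./2 - k) + 4 * k ^ 2 * 'C(n, n./2).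
Proof.
elim: k => [|k IH] lt_k; first by rewrite subn0; lia.
apply: leq_trans (IH (ltnW lt_k)) _.
have := mul_bin_left n (n./2 - k.+1).
have -> : (n./2 - k.+1).+1 = n./2 - k by lia.
have := bin_le_central n (n./2 - k).
move: 'C(n, n./2 - k) 'C(n, n./2 - k.+1) 'C(n, n./2) => x y z le_xz Exy.
(* One step down may cost [4 * k.+1], since [4 * k.+1 ^ 2 - 4 * k ^ 2 = 8 * k + 4]. *)
suff : n * x <= n * y + 4 * k.+1 * z by nia.
have : n = n./2 + n./2 + odd n by lia.
move: (n./2) (odd n) lt_k Exy => h b lt_kh Exy En; subst n.
have le_b : b <= 1 by case: (b).
have {}Exy : (h - k) * x = (h + b + k.+1) * y by rewrite Exy; congr (_ * _); lia.
have le_yx : y <= x by nia.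
(* The two factors in [Exy] differ by [b + k.*2.+1]. As [n <= 2 * (h + b + k.+1)], doubling the
   bound [2 * k.+1 * z] yields the constant 4. *)
have : (h + b + k.+1) * x = (h + b + k.+1) * y + (b + k.*2.+1) * x by nia.
have : (b + k.*2.+1) * x <= 2 * k.+1 * z by apply: leq_mul => //; lia.
nia.
Qed.

(** Here [n <= 2 * (n - i)], and [(n - i) * 'C(n, i) = i.+1 * 'C(n, i.+1)]. *)
Lemma bin_far_central n i : i.*2 <= n ->
  n * 'C(n, i) <= 2 * i.+1 * 'C(n, n./2).
Proof.
move=> le_in; have := mul_bin_left n i.
have := bin_le_central n i.+1.
move: 'C(n, i) 'C(n, i.+1) 'C(n, n./2) => x y z le_yz Exy.
have : n * x <= 2 * ((n - i) * x) by nia.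
nia.
Qed.

(** * Sums over subsets grouped by size *)

Lemma card_set_size_sum n (p : pred nat) (V : nmodType) (g : nat -> V) :
  (\sum_(A : {set 'I_n} | p #|A|) g #|A| =
   \sum_(0 <= i < n.+1 | p i) g i *+ 'C(n, i))%R.
Proof.
rewrite big_mkord.
rewrite (partition_big (fun A : {set 'I_n} => inord #|A| : 'I_n.+1) (fun i : 'I_n.+1 => p i)) /=.
  apply: eq_bigr => i pi.
  have cardA (A : {set 'I_n}) : (#|A| < n.+1)%N.
    by rewrite ltnS -[leqRHS]card_ord max_card.
  rewrite (eq_bigl (fun A : {set 'I_n} => A \in [set A : {set 'I_n} | #|A| == i])).
    rewrite (eq_bigr (fun=> g i)); last by move=> A; rewrite inE => /eqP->.
    by rewrite sumr_const card_draws card_ord.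
  move=> A; rewrite inE -val_eqE /= inordK //.
  by case: eqP => [->|_]; rewrite ?pi ?andbF.
move=> A pA; rewrite inordK //.
by rewrite ltnS -[leqRHS]card_ord max_card.
Qed.

(** * Full chains meet every level exactly once *)

Lemma is_chainP n (C : {set {set 'I_n}}) :
  reflect {in C &, forall A B : {set _}, (A \subset B) || (B \subset A)} (is_chain C).
Proof.
apply: (iffP forall_inP) => [h A B inA inB|h A inA].
  by have /forall_inP := h A inA; apply.
by apply/forall_inP => B; apply: h.
Qed.

Lemma full_chain_comparable n (C : {set {set 'I_n}}) (D : {set 'I_n}) :
    C \in full_chains n ->
    (forall A, A \in C -> (A \subset D) || (D \subset A)) -> D \in C.
Proof.
rewrite inE => /maxsetP[/is_chainP chC maxC] cmpD.
suff <- : D |: C = C by rewrite setU11.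
apply: maxC; last exact: finset.subsetUr.
apply/is_chainP => A B /setU1P[->|inA] /setU1P[->|inB].
- by rewrite fintype.subxx.
- by rewrite orbC cmpD.
- exact: cmpD.
- exact: chC.
Qed.

Lemma intermediate_set (T : finType) (A B : {set T}) k :
  A \subset B -> #|A| <= k <= #|B| ->
  exists D : {set T}, [/\ A \subset D, D \subset B & #|D| = k].
Proof.
move=> sAB /andP[leAk lekB].
have /card_geqP[s [us ss sB]] : k - #|A| <= #|B :\: A|.
  by rewrite cardsDS //; lia.
exists (A :|: [set x in s]); split; first exact: finset.subsetUl.
  rewrite finset.subUset sAB; apply/fintype.subsetP => x; rewrite inE => /sB.
  by rewrite inE => /andP[].
rewrite cardsU (_ : A :&: _ = finset.set0) ?cards0; last first.
  apply/finset.setP => x; rewrite !inE; apply/negP => /andP[xA /sB].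
  by rewrite inE xA.
by rewrite subn0 cardsE (card_uniqP us) ss; lia.
Qed.

(** If level [k] were missed, a set of size [k] between the largest member [L] below it and the
    smallest member [U] above it would be comparable to all of [C], hence in [C] by maximality. *)
Lemma full_chain_level_exists n (C : {set {set 'I_n}}) k :
  C \in full_chains n -> k <= n -> exists2 A, A \in C & #|A| == k.
Proof.
move=> Cfull le_kn; apply/exists_inP; apply: contraT => /exists_inPn noC.
have /is_chainP chC : is_chain C by move: Cfull; rewrite inE => /maxsetP[].
have C0 : finset.set0 \in C.
  by apply: full_chain_comparable => // A _; rewrite finset.sub0set orbT.
have CT : finset.setT \in C.
  by apply: full_chain_comparable => // A _; rewrite finset.subsetT.
(* The empty and the full set witness that [L] and [U] exist; neither has size [k], as level [k] is
   missed. *)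
have k0 : (finset.set0 \in C) && (#|@finset.set0 'I_n| < k).
  by rewrite C0 cards0 lt0n eq_sym; have := noC _ C0; rewrite cards0.
have kT : (finset.setT \in C) && (k < #|[set: 'I_n]|).
  have := noC _ CT; rewrite CT cardsT card_ord => /negP nk.
  by rewrite ltn_neqAle le_kn andbT eq_sym; apply/negP.
pose L := [arg max_(A > finset.set0 | (A \in C) && (#|A| < k)) #|A|]%N.
pose U := [arg min_(A < finset.setT | (A \in C) && (k < #|A|)) #|A|]%N.
have [LinC Lk maxL] : [/\ L \in C, #|L| < k &
    forall A, A \in C -> #|A| < k -> #|A| <= #|L|].
  rewrite /L; case: arg_maxnP => // A /andP[inA Ak] mA.
  by split=> // B inB Bk; apply: mA; rewrite inB.
have [UinC Uk minU] : [/\ U \in C, k < #|U| &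
    forall A, A \in C -> k < #|A| -> #|U| <= #|A|].
  rewrite /U; case: arg_minnP => // A /andP[inA Ak] mA.
  by split=> // B inB Bk; apply: mA; rewrite inB.
have sub_card A B : A \in C -> B \in C -> #|A| <= #|B| -> A \subset B.
  move=> inA inB leAB; case/orP: (chC A B inA inB) => // sBA.
  by have /eqP-> : B == A by rewrite eqEcard sBA.
have sLU : L \subset U by apply: sub_card => //; lia.
have [|D [LD DU Dk]] := @intermediate_set _ L U k sLU; first by lia.
have /noC : D \in C; last by rewrite Dk eqxx.
apply: full_chain_comparable => // A inA.
case: (ltngtP #|A| k) => [lt|gt|/eqP eq]; last by have := noC _ inA; rewrite eq.
  by rewrite (fintype.subset_trans (sub_card _ _ inA LinC (maxL _ inA lt))).
by rewrite (fintype.subset_trans DU (sub_card _ _ UinC inA (minU _ inA gt))) orbT.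
Qed.

Lemma full_chain_level n (C : {set {set 'I_n}}) k :
  C \in full_chains n -> k <= n -> #|[set A in C | #|A| == k]| = 1.
Proof.
move=> Cfull le_kn; have [A inA Ak] := full_chain_level_exists Cfull le_kn.
have /is_chainP chC : is_chain C by move: Cfull; rewrite inE => /maxsetP[].
apply/eqP/cards1P; exists A; apply/finset.setP => B; rewrite !inE.
apply/andP/eqP => [[inB Bk]|-> //]; apply/eqP.
case/orP: (chC A B inA inB) => sAB; last by rewrite eqEcard sAB (eqP Ak) (eqP Bk) /=.
by rewrite eq_sym eqEcard sAB (eqP Ak) (eqP Bk) /=.
Qed.

(** * Permutations of the ground set and the Lubell weights *)

Lemma imset_perm_exists (T : finType) (A B : {set T}) :
  #|A| = #|B| -> exists s : {perm T}, s @: A = B.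
Proof.
(* List each set before its complement and match positions: the first [#|A|] positions send [A] onto
   [B]. *)
move=> eqAB; pose e (X : {set T}) := enum X ++ enum (~: X).
have memX X x : x \in e X by rewrite mem_cat !mem_enum inE orbN.
have ue X : uniq (e X).
  rewrite cat_uniq !enum_uniq andbT /=; apply/hasPn => x.
  by rewrite !mem_enum inE.
have sz : size (e A) = size (e B).
  rewrite !size_cat -!cardE eqAB; congr (_ + _).
  by apply/eqP; rewrite -(eqn_add2l #|A|) cardsC eqAB cardsC.
pose f x := nth x (e B) (index x (e A)).
have injf : injective f.
  move=> x y; rewrite /f (set_nth_default y) -?sz ?index_mem // => /eqP.
  rewrite nth_uniq -?sz ?index_mem // => /eqP/(congr1 (nth x (e A))).
  by rewrite !nth_index.
exists (perm injf); apply/eqP; rewrite eqEcard card_imset ?eqAB ?leqnn ?andbT.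
  apply/fintype.subsetP => _ /imsetP[x xA ->]; rewrite permE /f /e.
  have lt : index x (enum A ++ enum (~: A)) < #|B|.
    by rewrite index_cat mem_enum xA -eqAB cardE index_mem mem_enum.
  by rewrite nth_cat -cardE lt -mem_enum mem_nth // -cardE.
exact: perm_inj.
Qed.

Lemma full_chains_perm n (s : {perm 'I_n}) (C : {set {set 'I_n}}) :
  C \in full_chains n ->
  (imset (fun A : {set 'I_n} => s @: A) (mem C)) \in full_chains n.
Proof.
have chain_perm (t : {perm 'I_n}) (D : {set {set 'I_n}}) : is_chain D ->
    is_chain [set t @: A | A : {set 'I_n} in D].
  move=> /is_chainP chD; apply/is_chainP => _ _ /imsetP[A AD ->] /imsetP[B BD ->].
  by case/orP: (chD A B AD BD) => sAB; rewrite (imsetS _ sAB) ?orbT.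
have permK (t : {perm 'I_n}) (A : {set 'I_n}) : t @: ((t^-1)%g @: A) = A.
  by rewrite -imset_comp -[RHS]imset_id; apply: eq_imset => x /=; rewrite permKV.
rewrite !inE => /maxsetP[chC maxC]; apply/maxsetP; split; first exact: chain_perm.
move=> D chD sCD.
have sCD' : C \subset [set (s^-1)%g @: A | A : {set 'I_n} in D].
  apply/fintype.subsetP => A inA; apply/imsetP; exists (s @: A).
    by apply: (fintype.subsetP sCD); apply: imset_f.
  by rewrite -{2}(invgK s) permK.
rewrite -(maxC _ (chain_perm _ _ chD) sCD').
by rewrite -imset_comp -[LHS]imset_id; apply: eq_imset => A /=; rewrite permK.
Qed.

(** A permutation taking [A] to [B] maps the full chains through [A] injectively to full chains
    through [B]. Equality follows by exchanging [A] and [B]. *)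
Lemma full_chains_through_card n (A B : {set 'I_n}) : #|A| = #|B| ->
  #|[set C in full_chains n | A \in C]| <= #|[set C in full_chains n | B \in C]|.
Proof.
case/imset_perm_exists => s <-.
have inj1 : injective (fun X : {set 'I_n} => s @: X) := imset_inj (@perm_inj _ s).
have inj2 := imset_inj inj1.
rewrite -(card_imset _ inj2); apply: subset_leq_card.
apply/fintype.subsetP => _ /imsetP[C + ->].
rewrite finset.in_set => /andP[Cfull inA]; rewrite finset.in_set.
by rewrite full_chains_perm // imset_f.
Qed.

(** Double counting of the pairs of a full chain and a member [B] of it with [#|B| = #|A|]. *)
Lemma full_chains_through n (A : {set 'I_n}) :
  'C(n, #|A|) * #|[set C in full_chains n | A \in C]| = #|full_chains n|.
Proof.
have le_An : #|A| <= n by rewrite -[leqRHS]card_ord max_card.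
have -> : #|full_chains n| =
    \sum_(C in full_chains n) #|[set B in C | #|B| == #|A|]|.
  by rewrite -sum1_card; apply: eq_bigr => C Cfull; rewrite full_chain_level.
under eq_bigr do rewrite -sum1dep_card big_mkcondr /=.
under eq_bigr do rewrite big_mkcond /=.
rewrite exchange_big /=.
rewrite (bigID (fun B : {set 'I_n} => #|B| == #|A|)) /= [X in _ = _ + X]big1 ?addn0.
  rewrite (eq_bigr (fun=> #|[set C in full_chains n | A \in C]|)).
    rewrite sum_nat_const; congr (_ * _).
    by rewrite -[in RHS]cardsE card_draws card_ord.
  move=> B /eqP eqB; rewrite eqB eqxx -big_mkcondr /= sum1dep_card.
  by apply/eqP; rewrite eqn_leq !full_chains_through_card.
by move=> B /negPf->; apply: big1 => C _; case: ifP.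
Qed.

(** After exchanging the sums, [A] contributes the proportion of full chains through it. *)
Lemma lubellE n (F : {set {set 'I_n}}) :
  lubell F = (\sum_(A in F) ('C(n, #|A|)%:R)^-1)%R.
Proof.
have full_gt0 : 0 < #|full_chains n|.
  have [|C maxC _] := @maxset_exists _ (@is_chain n) finset.set0.
    by apply/is_chainP => A B; rewrite inE.
  by apply/card_gt0P; exists C; rewrite inE.
rewrite /lubell natr_sum mulr_suml.
under eq_bigr do rewrite -sum1_card natr_sum mulr_suml big_mkcond /=.
rewrite exchange_big /= [RHS]big_mkcond; apply: eq_bigr => A _.
case: ifP => AF; last by apply: big1 => C _; rewrite inE AF.
under eq_bigr do rewrite inE AF /=.
rewrite -big_mkcondr /= -mulr_suml -natr_sum sum1dep_card.
have := full_gt0; rewrite -(full_chains_through A) muln_gt0 => /andP[C_gt0 N_gt0].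
by rewrite natrM; field; rewrite !pnatr_eq0 -!lt0n C_gt0.
Qed.

(** The codomain is general because both cardinalities in [nat] and Lubell weights in [rat] are
    summed this way. *)
Lemma sum_levels n a b (V : nmodType) (g : nat -> V) : b <= n.+1 ->
  (\sum_(A : {set 'I_n} | (a <= #|A| < b)%N) g #|A| =
   \sum_(a <= i < b) g i *+ 'C(n, i))%R.
Proof.
move=> le_bn; rewrite (@card_set_size_sum n (fun i => a <= i < b)).
by rewrite [RHS](@big_nat_widenl _ _ _ a 0) // [RHS](@big_nat_widen _ _ _ _ _ n.+1) //.
Qed.

Lemma card_levels n a b : b <= n.+1 ->
  #|[set A : {set 'I_n} | a <= #|A| < b]| = \sum_(a <= i < b) 'C(n, i).
Proof.
move=> le_bn; rewrite -sum1dep_card (@sum_levels n a b nat (fun=> 1%N)) //.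
by apply: eq_bigr => i _; rewrite -[RHS]natn.
Qed.

(* Let [M] be the [e] middle levels and [c] their smallest binomial
   coefficient, which bounds those of all other levels. Then
   [1 - c / 'C(n, #|A|)] is nonnegative on [M] and nonpositive off [M], so that
   [|M| - |F| >= c (lubell M - lubell F)], where [lubell M = e]. *)
Lemma card_le_Sigma n (F : {set {set 'I_n}}) e :
  (lubell F <= e%:R)%R -> #|F| <= Sigma n e.
Proof.
have binA (A : {set 'I_n}) : 0 < 'C(n, #|A|).
  by rewrite bin_gt0 -[leqRHS]card_ord max_card.
rewrite lubellE /Sigma; set a := (n.+1 - e)./2; set b := (n + e).+1./2.
case: (leqP e n) => [le_en|lt_ne] le_e; last first.
  (* For [e > n] the range covers all levels, so [Sigma n e] counts every subset. *)
  have -> : a = 0 by rewrite /a; lia.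
  have le_nb : n.+1 <= b by rewrite /b; lia.
  rewrite (big_cat_nat _ le_nb) //= -card_levels //.
  apply: leq_trans (leq_addr _ _); apply: subset_leq_card.
  apply/fintype.subsetP => A _; rewrite inE /= ltnS.
  by rewrite -[leqRHS]card_ord max_card.
have le_bn : b <= n.+1 by rewrite /b; lia.
have le_an : a <= n by rewrite /a; lia.
have ba : b - a = e by rewrite /a /b; lia.
rewrite -card_levels //; set M := [set A | _].
(* Since [a + b] is [n] or [n + 1], level [a] is as far from the centre as any level of [M] and no
   farther than any level outside. *)
pose c : rat := ('C(n, a)%:R)%R; pose w (A : {set 'I_n}) : rat := ('C(n, #|A|)%:R^-1)%R.
have lubM : (\sum_(A in M) w A = e%:R)%R.
  under eq_bigl do rewrite inE.
  rewrite (@sum_levels n a b rat (fun i => ('C(n, i)%:R^-1)%R)) //.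
  rewrite -ba -[(b - a)%N]muln1 -sum_nat_const_nat natr_sum.
  apply: eq_big_nat => i /andP[_ ib]; rewrite -[LHS]mulr_natr mulVf //.
  by rewrite pnatr_eq0 -lt0n bin_gt0; lia.
have key A : (((A \in F)%:R - (A \in M)%:R) * (1 - c * w A) <= 0)%R.
  case AM: (A \in M).
    have : (c * w A <= 1)%R.
      rewrite ler_pdivrMr ?ltr0n // mul1r ler_nat bin_le_minn //.
        by rewrite -[leqRHS]card_ord max_card.
      by move: AM; rewrite inE /a /b; lia.
    by case: (A \in F); rewrite ?subrr ?mul0r ?sub0r ?mulN1r //; lra.
  have : (1 <= c * w A)%R.
    rewrite ler_pdivlMr ?ltr0n // mul1r ler_nat bin_le_minn //.
    by move: AM; rewrite inE /a /b; have := max_card (mem A); rewrite card_ord; lia.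
  by case: (A \in F); rewrite subr0 ?mul0r ?mul1r //; lra.
have sumE (X : {set {set 'I_n}}) (g : {set 'I_n} -> rat) :
    (\sum_A (A \in X)%:R * g A = \sum_(A in X) g A)%R.
  rewrite [RHS]big_mkcond; apply: eq_bigr => A _.
  by case: (A \in X); rewrite ?mul1r ?mul0r.
have : (\sum_A ((A \in F)%:R - (A \in M)%:R) * (1 - c * w A) <= 0 :> rat)%R.
  by apply: sumr_le0 => A _; apply: key.
under eq_bigr do rewrite mulrBl.
rewrite sumrB !sumE !sumrB -!mulr_sumr lubM !sumr_const.
have : (c * \sum_(A in F) w A <= c * e%:R)%R by rewrite ler_wpM2l // ler0n.
by move=> h1 h2; rewrite -(ler_nat rat); lra.
Qed.

(** * Upper bound on the size of a free family *)

Lemma bounded_free_card m (d : Order.disp_t) (P : finPOrderType d) n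
    (F : {set {set 'I_n}}) :
  L_bounded m P -> is_free P F ->
  #|F| <= Sigma n (e_of P) + 2 * \sum_(0 <= i < m) 'C(n, i).
Proof.
move=> P_bounded F_free.
pose mid := [set A : {set 'I_n} | m <= #|A| <= n - m].
pose low := [set A : {set 'I_n} | #|A| < m].
have cardA (A : {set 'I_n}) : #|A| <= n by rewrite -[leqRHS]card_ord max_card.
have le_mid : #|F :&: mid| <= Sigma n (e_of P).
  apply/card_le_Sigma/P_bounded => [|A]; last by rewrite !inE => /andP[].
  apply: contra F_free => /existsP[f /and3P[injf fF monof]].
  apply/existsP; exists f; rewrite injf monof andbT /=.
  by apply/forallP => u; have := forallP fF u; rewrite inE => /andP[].
have le_low : #|low| <= \sum_(0 <= i < m) 'C(n, i).
  (* The minimum meets the hypothesis of [card_levels] even when [m > n.+1]. *)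
  have -> : low = [set A : {set 'I_n} | 0 <= #|A| < minn m n.+1].
    by apply/finset.setP => A; rewrite !inE leq_min ltnS cardA andbT.
  rewrite card_levels ?geq_minr //.
  by rewrite [leqRHS](@big_cat_nat _ _ _ (minn m n.+1)) ?geq_minl //= leq_addr.
(* Complementation turns the sets smaller than [m] into those larger than [n - m], whence the factor
   2. *)
have card_high : #|[set ~: A | A in low]| = #|low|.
  by apply: card_imset; apply: finset.setC_inj.
have sF : F \subset (F :&: mid) :|: (low :|: [set ~: A | A in low]).
  apply/fintype.subsetP => A AF; rewrite !inE AF /=.
  case: (leqP m #|A|) => //= le_mA; case: leqP => //= lt_A.
  apply/imsetP; exists (~: A); last by rewrite finset.setCK.
  rewrite inE; have := cardsC A; rewrite card_ord.
  by move: #|~: A| #|A| le_mA lt_A => x y; lia.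
apply: leq_trans (subset_leq_card sF) _.
apply: leq_trans (leq_card_setU _ _) (leq_add le_mid _).
apply: leq_trans (leq_card_setU _ _) _.
by rewrite card_high mulSn mul1n leq_add.
Qed.

(** * Asymptotics of [La] *)

Lemma La_lower (d : Order.disp_t) (P : finPOrderType d) k n :
  levels_free P k -> k.*2 <= n ->
  n * (k * 'C(n, n./2)) <= n * La n P + 4 * k ^ 3 * 'C(n, n./2).
Proof.
move=> Pk le_kn.
(* The lowest of the [k] levels used is the smallest. Its loss [4 * k ^ 2] from [bin_near_central],
   taken [k] times, gives [4 * k ^ 3]. *)
have : k * 'C(n, n./2 - k) <= La n P.
  apply: leq_trans (leq_bigmax_cond _ (Pk n (Posz (n./2 - k)))).
  have -> : levels n (n./2 - k)%N k =
      [set A : {set 'I_n} | n./2 - k <= #|A| < n./2 - k + k].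
    by apply/finset.setP => A; rewrite !inE -PoszD ltz_nat lez_nat.
  rewrite card_levels; last by lia.
  rewrite -{1}(addKn (n./2 - k) k) -sum_nat_const_nat.
  rewrite big_nat_cond [leqRHS]big_nat_cond; apply: leq_sum => i /andP[/andP[le_i lt_i] _].
  by apply: bin_le_minn; lia.
have : k <= n./2 by lia.
move/bin_near_central.
move: ('C(n, n./2 - k)) ('C(n, n./2)) (La n P) => x z L hx hL.
have : k * (n * z) <= k * (n * x + 4 * k ^ 2 * z) by rewrite leq_mul2l hx orbT.
have : n * (k * x) <= n * L by rewrite leq_mul2l hL orbT.
by rewrite !expnS expn0; nia.
Qed.

Lemma Sigma_le_central n k : k <= n -> Sigma n k <= k * 'C(n, n./2).
Proof.
move=> le_kn; have {2}-> : k = (n + k).+1./2 - (n.+1 - k)./2 by lia.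
by rewrite -sum_nat_const_nat; apply: leq_sum => i _; apply: bin_le_central.
Qed.

Lemma sum_bin_small n m : m.*2 <= n ->
  n * \sum_(0 <= i < m) 'C(n, i) <= 2 * m ^ 2 * 'C(n, n./2).
Proof.
move=> le_mn; rewrite big_distrr /=.
apply: (@leq_trans (\sum_(0 <= i < m) 2 * m * 'C(n, n./2))); last first.
  by rewrite sum_nat_const_nat subn0; nia.
rewrite big_nat_cond [leqRHS]big_nat_cond; apply: leq_sum => i /andP[/andP[_ lt_im] _].
apply: leq_trans (bin_far_central _) _; first by lia.
by rewrite leq_mul2r leq_mul2l lt_im !orbT.
Qed.

(** Convergence at rate [K / n], with the division by [n] cleared to suit the bounds above. *)
Lemma cvg_dist_le_div (R : realType) (u : R^nat) (l : R) (K N : nat) :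
  (forall n, (N <= n)%N -> `|l - u n| * n%:R <= K%:R)%R ->
  (u n @[n --> \oo] --> l)%classic.
Proof.
move=> uK; apply/cvgrPdist_le => eps eps_gt0; near=> n.
have n_gt0 : (0 < n%:R :> R)%R by rewrite ltr0n; near: n; exists 1%N.
have le_Nn : N <= n by near: n; exists N.
rewrite -(ler_pM2r n_gt0); apply: le_trans (uK _ le_Nn) _.
rewrite -ler_pdivrMl //; near: n; exact: nbhs_infty_ger.
Unshelve. all: by end_near.
Qed.

Theorem proposition3p3 (R : realType) (m : nat) (d : Order.disp_t)
    (P : finPOrderType d) (P_gt0 : 0 < #|P|) (P_bounded : L_bounded m P) :
  (forall n : nat,
     La n P <= Sigma n (e_of P) + 2 * \sum_(0 <= i < m) 'C(n, i)) /\
  cvgn (La_ratio R P) /\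
  pi_limit R P = ((e_of P)%:R)%R.
Proof.
have La_upper n : La n P <= Sigma n (e_of P) + 2 * \sum_(0 <= i < m) 'C(n, i).
  by apply/bigmax_leqP => F; apply: bounded_free_card.
split=> //.
suff lim_e : (La_ratio R P n @[n --> \oo] --> ((e_of P)%:R : R)%R)%classic.
  by split; [apply/cvg_ex; eexists; exact: lim_e | exact: cvg_lim lim_e].
have [/La_lower lower _] := e_ofP P_gt0.
move: (e_of P) La_upper lower => e upper lower.
(* The term [4 * m ^ 2] is twice the bound of [sum_bin_small], and [4 * e ^ 3] comes from
   [La_lower]; the threshold ensures [m.*2 <= n] and [e.*2 <= n]. *)
apply: (@cvg_dist_le_div _ _ _ (4 * m ^ 2 + 4 * e ^ 3) (m.*2 + e.*2)) => n le_n.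
have le_low : n * (e * 'C(n, n./2)) <= n * La n P + 4 * e ^ 3 * 'C(n, n./2).
  by apply: lower; lia.
have le_up : n * La n P <= n * (e * 'C(n, n./2)) + 4 * m ^ 2 * 'C(n, n./2).
  have := @sum_bin_small n m; have := @Sigma_le_central n e.
  have := upper n; move: (Sigma n e) (\sum_(0 <= i < m) _) => s t h1 h2 h3.
  have {}h2 : s <= e * 'C(n, n./2) by apply: h2; lia.
  have {}h3 : n * t <= 2 * m ^ 2 * 'C(n, n./2) by apply: h3; lia.
  have : n * La n P <= n * (s + 2 * t) by rewrite leq_mul2l h1 orbT.
  have : n * s <= n * (e * 'C(n, n./2)) by rewrite leq_mul2l h2 orbT.
  by rewrite mulnDr; lia.
have z_gt0 : (0 < 'C(n, n./2)%:R :> R)%R by rewrite ltr0n bin_gt0; lia.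
(* With the powers as atoms and the denominator [z] cleared, both sides of the absolute value bound
   become linear in the remaining products. *)
move: (e ^ 3) (m ^ 2) le_low le_up z_gt0 => e3 m2.
rewrite /La_ratio -!(ler_nat R) !natrD !natrM.
move: ('C(n, n./2)%:R)%R => z le_low le_up z_gt0.
rewrite -[X in (_ * X)%R]ger0_norm ?ler0n // -normrM ler_norml.
rewrite -(ler_pM2r z_gt0) -[X in _ && X](ler_pM2r z_gt0).
have -> : ((e%:R - (La n P)%:R / z) * n%:R * z =
   n%:R * (e%:R * z) - n%:R * (La n P)%:R)%R by field; rewrite gt_eqF.
have : (0 <= e3%:R * z)%R by rewrite mulr_ge0 // ltW.
have : (0 <= m2%:R * z)%R by rewrite mulr_ge0 // ltW.
by move=> h1 h2; apply/andP; split; lra.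
Qed.
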